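(* Let $p$ be an integer with $p\notin\{0,1,2,3\}$ and let $f(z)=z^{p}$. For $c>0$ let $P_{c}$ denote the Taylor polynomial to $f$ of order $3$ at $c$. Then for any real numbers $0<a<b$, the polynomial $P_{b}-P_{a}$ has nonreal roots $x_{1}\pm iy_{1}$ (with $x_1,y_1\in\mathbb{R}$, $y_1\neq 0$) satisfying $a<x_{1}<b$.
   Context: The Taylor polynomial to $f$ of order $r$ at $c$ is $P_c(z)=\sum_{k=0}^{r}\frac{f^{(k)}(c)}{k!}(z-c)^k$, regarded as a polynomial in the complex variable $z$. *)

(* Defs.v *)
From mathcomp Require Import all_boot all_order all_algebra.
From mathcomp Require Import complex.
From mathcomp Require Import all_classical all_reals all_analysis.
Set Implicit Arguments.
Unset Strict Implicit.
Unset Printing Implicit Defensive.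
Import Order.TTheory GRing.Theory Num.Theory.
Import numFieldNormedType.Exports.
Local Open Scope classical_set_scope.
Local Open Scope complex_scope.
Local Open Scope ring_scope.

(* [f] is a function of a real variable, differentiated as such at [c]; the
   resulting real coefficients are embedded in [R[i]]. *)
Definition taylor_poly (R : realType) (f : R -> R) (r : nat) (c : R) :
    {poly R[i]} :=
  \sum_(k < r.+1) (derive1n k f c / k`!%:R)%:C *: ('X - (c%:C)%:P) ^+ k.

(* Main.v *)
Require Import Defs.
From mathcomp Require Import all_boot all_order all_algebra.
From mathcomp Require Import complex.
From mathcomp Require Import all_classical all_reals all_analysis.
From mathcomp Require Import ring lra zify.
Import Order.TTheory GRing.Theory Num.Theory.
Import numFieldNormedType.Exports.
Local Open Scope complex_scope.
Local Open Scope ring_scope.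

(** Since [d/dc P_c(x) = f''''(c) (x - c)^3 / 6], the cubic [P_b - P_a] is a
    nonzero constant times [G(x) = \int_a^b w(c) (x - c)^3 dc] with
    [w(c) = c^(p-4)].  Its coefficients are the moments of [w], and the strict
    Cauchy-Schwarz inequality for them leaves [G] with a single real root.  Let
    [M_k] be the moments of [w] in the variable [u = |c - e|], with [e] an
    endpoint.  By the Hurwitz criterion, the nonreal roots lie on the inner side
    of [e] iff [M_0 M_3 < 9 M_1 M_2].  At the endpoint from which [w] increases
    this holds because the mean of [w] is beyond the midpoint.  At the other one
    it follows from the recursion given by integration by parts; there the
    exponent matters, and the case [p <= -1] is sharp at [p = -1], [b -> oo]. *)

(** * Derivatives of integer powers *)

Lemma is_derive_exprz {R : realType} (k : int) (x : R) : x != 0 ->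
  is_derive x (1 : R) (fun y : R => y ^ k) (k%:~R * x ^ (k - 1)).
Proof.
move=> x0.
have dX (n : nat) :
    is_derive x (1 : R) (fun y : R => y ^+ n.+1) (n.+1%:R * x ^+ n).
  have := is_deriveX n.+1 (is_derive_id x (1 : R)).
  by rewrite exprfctE /GRing.scale /= mulr1.
case: (intP k) => [|n|n].
- rewrite mul0r; exact: (is_derive_cst (1 : R) x (1 : R)).
- by rewrite (_ : n.+1%:Z - 1 = n%:Z); [exact: dX | lia].
- rewrite (_ : (fun y : R => y ^ - n.+1%:Z) = (fun y => (y ^+ n.+1)^-1));
    last first.
    by apply/funext => y; rewrite exprnN.
  have xn0 : x ^+ n.+1 != 0 by rewrite expf_neq0.
  have H := @is_deriveV R (fun y : R => y ^+ n.+1) x _ 1 xn0 (dX n).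
  apply: (is_derive_eq H).
  have -> : x ^ (- n.+1%:Z - 1) = x ^- n.+2.
    by rewrite exprnN; congr (_ ^ _); lia.
  rewrite /GRing.scale /= rmorphN /= -pmulrn !exprS.
  by field; rewrite expf_neq0 // x0.
Qed.

Lemma derive1n_exprz {R : realType} (p : int) (k : nat) (c : R) : 0 < c ->
  derive1n k (fun x : R => x ^ p) c
  = (\prod_(j < k) (p - j%:Z)%:~R) * c ^ (p - k%:Z).
Proof.
elim: k c => [|k IH] c c0.
  by rewrite derive1n0 big_ord0 mul1r subr0.
rewrite derive1nS derive1E.
set D := \prod_(j < k) _ in IH.
(* The induction hypothesis covers positive points only, so it is used on a neighbourhood of [c]. *)
rewrite (@near_eq_derive _ _ _ _ (fun x : R => D * x ^ (p - k%:Z))); last first.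
  near=> x; apply: IH; near: x; exact: lt_nbhsr.
have H := is_derive_exprz (p - k%:Z) c (lt0r_neq0 c0).
have H2 := is_deriveZ D H.
rewrite (@derive_val _ _ _ _ _ _ _ H2) big_ord_recr /= -/D.
by rewrite /GRing.scale /= mulrA; congr (_ * _ ^ _); lia.
Unshelve. all: by end_near.
Qed.

(** * Moments of a power weight, via the mean value theorem *)

Lemma MVT_is_derive {R : realType} (F dF : R -> R) (a b : R) : a < b ->
  (forall x, a <= x <= b -> is_derive x (1 : R) F (dF x)) ->
  exists2 c, a < c < b & F b - F a = dF c * (b - a).
Proof.
move=> ab dFP.
have [||c] := @MVT R F dF a b ab; last by rewrite in_itv /=; exists c.
- by move=> x; rewrite in_itv /= => /andP[ax xb]; apply: dFP; rewrite !ltW.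
- apply: derivable_within_continuous => x; rewrite in_itv /= => xab.
  by have [] := dFP _ xab.
Qed.

Lemma is_derive_lt {R : realType} (F dF : R -> R) (a b : R) : a < b ->
  (forall x, a <= x <= b -> is_derive x (1 : R) F (dF x)) ->
  (forall x, a < x < b -> 0 < dF x) -> F a < F b.
Proof.
move=> ab dFP dF0; have [c cab eF] := MVT_is_derive F dF a b ab dFP.
by rewrite -subr_gt0 eF mulr_gt0 ?dF0 ?subr_gt0.
Qed.

(* Antiderivative of [c ^ (s - 1 + k)], so [s = p - 3]; the excluded values
   of [p] are those for which some [s + k] with [k < 4] vanishes and a logarithm
   would be needed. *)
Definition primitive {R : realType} (s : int) (k : nat) (c : R) : R :=
  c ^ (s + k%:Z) / (s + k%:Z)%:~R.

Definition moment {R : realType} (a b : R) (s : int) (k : nat) : R :=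
  primitive s k b - primitive s k a.

Lemma is_derive_primitive {R : realType} (s : int) (g0 g1 g2 g3 x : R) :
  0 < x -> (forall k, (k < 4)%N -> s + k%:Z != 0) ->
  is_derive x (1 : R)
    (fun c => g0 * primitive s 0 c + g1 * primitive s 1 c
            + g2 * primitive s 2 c + g3 * primitive s 3 c)
    (x ^ (s - 1) * (g0 + g1 * x + g2 * x ^+ 2 + g3 * x ^+ 3)).
Proof.
move=> x_gt0 hs.
have x0 : x != 0 by rewrite lt0r_neq0.
have dW (g : R) (k : nat) : (k < 4)%N ->
    is_derive x (1 : R) (fun c => g * primitive s k c) (g * x ^ (s + k%:Z - 1)).
  move=> k4; rewrite (_ : (fun c => _)
    = (fun c => (g / (s + k%:Z)%:~R) * c ^ (s + k%:Z))); last first.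
    by apply/funext => c; rewrite /primitive mulrAC mulrA.
  apply: (is_derive_eq (is_deriveZ (g / (s + k%:Z)%:~R)
    (is_derive_exprz (s + k%:Z) x x0))).
  by rewrite /GRing.scale /= mulrA mulfVK // intr_eq0 hs.
apply: (is_derive_eq (is_deriveD (is_deriveD (is_deriveD
  (dW g0 0%N _) (dW g1 1%N _)) (dW g2 2%N _)) (dW g3 3%N _))) => //.
have e (k : nat) : x ^ (s + k%:Z - 1) = x ^ (s - 1) * x ^+ k.
  by rewrite exprnP -expfzDr //; congr (_ ^ _); lia.
by rewrite !e; ring.
Qed.

(** The combination is the integral over [[a, b]] of [c ^ (s - 1)] times a cubic. The exceptional
    point [t] admits cubics with an interior zero, such as the square [(c - e) ^+ 2]. *)
Lemma moment_gt0 {R : realType} (a b t : R) (s : int) (g0 g1 g2 g3 : R) :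
  0 < a -> a < b -> (forall k, (k < 4)%N -> s + k%:Z != 0) ->
  (forall c, a < c < b -> c != t ->
    0 < g0 + g1 * c + g2 * c ^+ 2 + g3 * c ^+ 3) ->
  0 < g0 * moment a b s 0 + g1 * moment a b s 1
      + g2 * moment a b s 2 + g3 * moment a b s 3.
Proof.
move=> a0 ab hs g_gt0.
pose F c := g0 * primitive s 0 c + g1 * primitive s 1 c
            + g2 * primitive s 2 c + g3 * primitive s 3 c.
rewrite [ltRHS](_ : _ = F b - F a) ?subr_gt0; last by rewrite /F /moment; ring.
(* [F] increases strictly across any subinterval whose interior avoids [t]; if [t] is inside,
   [[a, b]] is cut there. *)
have Flt (u v : R) : a <= u -> u < v -> v <= b -> ~~ (u < t < v) -> F u < F v.
  move=> au uv vb tuv.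
  apply: (is_derive_lt _ (fun x => x ^ (s - 1)
    * (g0 + g1 * x + g2 * x ^+ 2 + g3 * x ^+ 3)) _ _ uv) => x xuv.
    by apply: is_derive_primitive => //; lra.
  apply: mulr_gt0; first by rewrite exprz_gt0 //; lra.
  by apply: g_gt0; [lra | apply: contraNneq tuv => <-].
case: (boolP (a < t < b)) => [/andP[at_ tb]|tab]; last exact: Flt.
by apply: lt_trans (Flt a t _ _ _ _) (Flt t b _ _ _ _);
  rewrite ?lexx ?ltxx ?andbF //; lra.
Qed.

(** The left side integrates [2 * c - (a + b)] against the weight. This factor has integral zero, so
    the value of the weight at the midpoint can be subtracted for free; for a monotone weight the
    integrand then has constant sign. *)
Lemma moment_midpoint {R : realType} (a b : R) (s : int) :
  0 < a -> a < b -> (forall k, (k < 4)%N -> s + k%:Z != 0) ->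
  exists2 c, a < c < b &
    2 * moment a b s 1 - (a + b) * moment a b s 0
    = (c ^ (s - 1) - ((a + b) / 2) ^ (s - 1)) * (2 * c - (a + b)) * (b - a).
Proof.
move=> a0 ab hs.
set w := ((a + b) / 2) ^ (s - 1).
pose F c := (- (a + b) * primitive s 0 c + 2 * primitive s 1 c
            + 0 * primitive s 2 c + 0 * primitive s 3 c)
            - w *: (c ^+ 2 - (a + b) *: c).
have dF x : a <= x <= b ->
    is_derive x (1 : R) F ((x ^ (s - 1) - w) * (2 * x - (a + b))).
  move=> xab; have x0 : 0 < x by lra.
  have dP := is_derive_primitive s (- (a + b)) 2 0 0 x x0 hs.
  have dX : is_derive x (1 : R) (fun c : R => w *: (c ^+ 2 - (a + b) *: c))
      (w * (2 * x - (a + b))).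
    have := is_deriveZ w (is_deriveB
      (is_deriveX 2 (is_derive_id x (1 : R)))
      (is_deriveZ (a + b) (is_derive_id x (1 : R)))).
    by rewrite exprfctE /GRing.scale /= !mulr1.
  apply: (is_derive_eq (is_deriveB dP dX)).
  by ring.
have [c cab eF] := MVT_is_derive F _ a b ab dF.
by exists c => //; rewrite -eF /F /moment /GRing.scale /=; ring.
Qed.

Lemma momentE {R : realType} (a b : R) (s : int) (k : nat) :
  0 < a -> 0 < b -> s + k%:Z != 0 ->
  (s%:~R + k%:R) * moment a b s k = b ^+ k * b ^ s - a ^+ k * a ^ s.
Proof.
move=> a0 b0 sk.
have e (c : R) : 0 < c -> c ^ (s + k%:Z) = c ^+ k * c ^ s.
  by move=> c0; rewrite addrC expfzDr ?lt0r_neq0.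
have : (s + k%:Z)%:~R != 0 :> R by rewrite intr_eq0.
rewrite /moment /primitive !e // intrD => skR.
by rewrite -mulrBl mulrC mulfVK.
Qed.

(** * Two sufficient conditions for the Hurwitz inequality *)

(* [e] is the endpoint and [E] the value of [c ^ s] at the opposite one. *)
Lemma hurwitz_of_recursion {R : realType} (e E L al be M0 M1 M2 M3 : R) :
  0 < e -> 0 < E -> 0 < L -> al <= 3 * be -> 0 < M1 -> 0 < M3 ->
  M3 < L ^+ 2 * M1 ->
  e * M0 = E * L + al * M1 -> 3 * (e * M2) = E * L ^+ 3 + be * M3 ->
  M0 * M3 < 9 * M1 * M2.
Proof.
move=> e0 E0 L0 albe M1_gt0 M3_gt0 M31 r0 r2.
rewrite -(ltr_pM2l e0) -subr_gt0.
have -> : e * (9 * M1 * M2) - e * (M0 * M3)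
    = E * L * (3 * (L ^+ 2 * M1) - M3) + (3 * be - al) * (M1 * M3).
  have -> : e * (9 * M1 * M2) = 3 * M1 * (3 * (e * M2)) by ring.
  by rewrite [e * (M0 * M3)]mulrA r0 r2; ring.
apply: ltr_pwDl; first by rewrite !mulr_gt0 //; nra.
by rewrite mulr_ge0 ?subr_ge0 // mulr_ge0 ?ltW.
Qed.

(** [L * M0 <= 2 * M1] puts the mean at or beyond the midpoint of an interval of length [L]. The
    chain [M0 * M3 < L * M0 * M2 <= 2 * M1 * M2] leaves ample room below 9. *)
Lemma hurwitz_of_mean {R : realType} (L M0 M1 M2 M3 : R) :
  0 < M0 -> 0 < M1 -> 0 < M2 -> M3 < L * M2 -> L * M0 <= 2 * M1 ->
  M0 * M3 < 9 * M1 * M2.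
Proof.
move=> M0_gt0 M1_gt0 M2_gt0 M32 M01.
have h1 : M0 * M3 < M0 * (L * M2) by rewrite ltr_pM2l.
have h2 : L * M0 * M2 <= 2 * M1 * M2 by rewrite ler_pM2r.
have h3 : 0 < M1 * M2 by rewrite mulr_gt0.
lra.
Qed.

Lemma exprz_diff_ge0 {R : realType} (x y : R) (k : int) :
  0 < x -> 0 < y -> 0 <= k -> 0 <= (x ^ k - y ^ k) * (x - y).
Proof.
move=> x0 y0 k0.
by case: (leP y x) => [yx|/ltW xy]; [rewrite mulr_ge0 | rewrite mulr_le0];
  rewrite ?(subr_ge0, subr_le0) // ler_wpXz2r // nnegrE ltW.
Qed.

Lemma exprz_diff_le0 {R : realType} (x y : R) (k : int) :
  0 < x -> 0 < y -> k <= 0 -> (x ^ k - y ^ k) * (x - y) <= 0.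
Proof.
move=> x0 y0 k0.
by case: (leP y x) => [yx|/ltW xy];
  [rewrite mulr_le0_ge0 | rewrite mulr_ge0_le0];
  rewrite ?(subr_ge0, subr_le0) // ler_wnXz2r.
Qed.

(** * Moments centred at a point *)

(** These are the binomial expansions of the integrals of [(c - e) ^+ k] against the weight, for [k]
    = 1, 2, 3. They are signed: at [e = b] the odd ones are the opposites of the moments in [b - c].
    The third is [- G(e)]. *)
Definition cmoment1 {R : realType} (a b : R) (s : int) (e : R) : R :=
  moment a b s 1 - e * moment a b s 0.

Definition cmoment2 {R : realType} (a b : R) (s : int) (e : R) : R :=
  moment a b s 2 - 2 * e * moment a b s 1 + e ^+ 2 * moment a b s 0.

Definition cmoment3 {R : realType} (a b : R) (s : int) (e : R) : R :=
  moment a b s 3 - 3 * e * moment a b s 2 + 3 * e ^+ 2 * moment a b s 1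
  - e ^+ 3 * moment a b s 0.

(** Integrate the derivative of [c ^ s * (c - e) ^+ k] for [k] = 1 and 3, splitting [c ^ s] as
    [c ^ (s - 1) * ((c - e) + e)]. At an endpoint [e] one boundary term vanishes. *)
Lemma cmoment_recursion {R : realType} (a b : R) (s : int) (e : R) :
  0 < a -> 0 < b -> (forall k, (k < 4)%N -> s + k%:Z != 0) ->
  e * moment a b s 0
    = b ^ s * (b - e) - a ^ s * (a - e) - (s%:~R + 1) * cmoment1 a b s e /\
  3 * (e * cmoment2 a b s e)
    = b ^ s * (b - e) ^+ 3 - a ^ s * (a - e) ^+ 3
      - (s%:~R + 3) * cmoment3 a b s e.
Proof.
move=> a0 b0 hs; set m := moment a b s.
have eM (k : nat) : (k < 4)%N ->
    s%:~R * m k = b ^+ k * b ^ s - a ^+ k * a ^ s - k%:R * m k.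
  by move=> k4; rewrite -(momentE a b s k a0 b0 (hs k k4)) /m; ring.
have e0 := eM 0%N isT; have e1 := eM 1%N isT.
have e2 := eM 2%N isT; have e3 := eM 3%N isT.
rewrite /cmoment1 /cmoment2 /cmoment3 -/m; split.
  rewrite (_ : (s%:~R + 1) * _
    = s%:~R * m 1%N - e * (s%:~R * m 0%N) + (m 1%N - e * m 0%N)); last by ring.
  by rewrite e0 e1; ring.
rewrite (_ : (s%:~R + 3) * _
  = s%:~R * m 3%N - 3 * e * (s%:~R * m 2%N) + 3 * e ^+ 2 * (s%:~R * m 1%N)
    - e ^+ 3 * (s%:~R * m 0%N)
    + 3 * (m 3%N - 3 * e * m 2%N + 3 * e ^+ 2 * m 1%N - e ^+ 3 * m 0%N));
  last by ring.
by rewrite e0 e1 e2 e3; ring.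
Qed.

Lemma moment0_gt0 {R : realType} (a b : R) (s : int) :
  0 < a -> a < b -> (forall k, (k < 4)%N -> s + k%:Z != 0) ->
  0 < moment a b s 0.
Proof.
move=> a0 ab hs; have := moment_gt0 a b a s 1 0 0 0 a0 ab hs.
by rewrite mul1r !mul0r !addr0; apply => c _ _; rewrite !mul0r !addr0.
Qed.

Lemma cmoment2_gt0 {R : realType} (a b : R) (s : int) (e : R) :
  0 < a -> a < b -> (forall k, (k < 4)%N -> s + k%:Z != 0) ->
  0 < cmoment2 a b s e.
Proof.
move=> a0 ab hs.
rewrite [ltRHS](_ : _ = e ^+ 2 * moment a b s 0 + (- 2 * e) * moment a b s 1
  + 1 * moment a b s 2 + 0 * moment a b s 3); last by rewrite /cmoment2; ring.
apply: (moment_gt0 _ _ e) => // c _ ce.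
rewrite [ltRHS](_ : _ = (c - e) ^+ 2); last by ring.
by rewrite exprn_even_gt0 //= subr_eq0.
Qed.

(** The gap is [moment a b s 0] times the second moment centred at the mean. *)
Lemma moment_cauchy_schwarz {R : realType} (a b : R) (s : int) :
  0 < a -> a < b -> (forall k, (k < 4)%N -> s + k%:Z != 0) ->
  moment a b s 1 ^+ 2 < moment a b s 0 * moment a b s 2.
Proof.
move=> a0 ab hs.
have m0 := moment0_gt0 a b s a0 ab hs.
have c2 := cmoment2_gt0 a b s (moment a b s 1 / moment a b s 0) a0 ab hs.
rewrite -subr_gt0 [ltRHS](_ : _ = moment a b s 0
  * cmoment2 a b s (moment a b s 1 / moment a b s 0)); first exact: mulr_gt0.
by rewrite /cmoment2; field; rewrite lt0r_neq0.
Qed.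

(** With [u = c - a] and [L = b - a], the four integrands are [u], [u ^+ 3], [u * (L ^+ 2 - u ^+ 2)]
    and [u ^+ 2 * (L - u)], all positive inside the interval. *)
Lemma cmoment_left {R : realType} (a b : R) (s : int) :
  0 < a -> a < b -> (forall k, (k < 4)%N -> s + k%:Z != 0) ->
  [/\ 0 < cmoment1 a b s a, 0 < cmoment3 a b s a,
      cmoment3 a b s a < (b - a) ^+ 2 * cmoment1 a b s a
    & cmoment3 a b s a < (b - a) * cmoment2 a b s a].
Proof.
move=> a0 ab hs.
rewrite -[_ < _ * cmoment1 _ _ _ _]subr_gt0 -[_ < _ * cmoment2 _ _ _ _]subr_gt0.
have pos g0 g1 g2 g3 := moment_gt0 a b a s g0 g1 g2 g3 a0 ab hs.
split.
- rewrite [ltRHS](_ : _ = (- a) * moment a b s 0 + 1 * moment a b s 1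
    + 0 * moment a b s 2 + 0 * moment a b s 3); last by rewrite /cmoment1; ring.
  by apply: pos => c cab _; lra.
- rewrite [ltRHS](_ : _ = (- a ^+ 3) * moment a b s 0
    + (3 * a ^+ 2) * moment a b s 1 + (- 3 * a) * moment a b s 2
    + 1 * moment a b s 3); last by rewrite /cmoment3; ring.
  apply: pos => c cab _.
  rewrite [ltRHS](_ : _ = (c - a) ^+ 3); last by ring.
  by rewrite exprn_gt0 //; lra.
- rewrite [ltRHS](_ : _ = (a ^+ 3 - a * (b - a) ^+ 2) * moment a b s 0
    + ((b - a) ^+ 2 - 3 * a ^+ 2) * moment a b s 1
    + (3 * a) * moment a b s 2 + (- 1) * moment a b s 3); last first.
    by rewrite /cmoment3 /cmoment1; ring.
  apply: pos => c cab _.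
  rewrite [ltRHS](_ : _ = (c - a) * (b - c) * (c + b - 2 * a)); last by ring.
  by rewrite !mulr_gt0 //; lra.
- rewrite [ltRHS](_ : _ = (b * a ^+ 2) * moment a b s 0
    + (- (a ^+ 2 + 2 * a * b)) * moment a b s 1
    + (b + 2 * a) * moment a b s 2 + (- 1) * moment a b s 3); last first.
    by rewrite /cmoment3 /cmoment2; ring.
  apply: pos => c cab _.
  rewrite [ltRHS](_ : _ = (c - a) ^+ 2 * (b - c)); last by ring.
  by rewrite mulr_gt0 ?exprn_gt0 //; lra.
Qed.

(** The same four integrands, now with [u = b - c]. *)
Lemma cmoment_right {R : realType} (a b : R) (s : int) :
  0 < a -> a < b -> (forall k, (k < 4)%N -> s + k%:Z != 0) ->
  [/\ 0 < - cmoment1 a b s b, 0 < - cmoment3 a b s b,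
      - cmoment3 a b s b < (b - a) ^+ 2 * - cmoment1 a b s b
    & - cmoment3 a b s b < (b - a) * cmoment2 a b s b].
Proof.
move=> a0 ab hs.
rewrite -[_ < _ * - _]subr_gt0 -[_ < _ * cmoment2 _ _ _ _]subr_gt0.
have pos g0 g1 g2 g3 := moment_gt0 a b a s g0 g1 g2 g3 a0 ab hs.
split.
- rewrite [ltRHS](_ : _ = b * moment a b s 0 + (- 1) * moment a b s 1
    + 0 * moment a b s 2 + 0 * moment a b s 3); last by rewrite /cmoment1; ring.
  by apply: pos => c cab _; lra.
- rewrite [ltRHS](_ : _ = (b ^+ 3) * moment a b s 0
    + (- 3 * b ^+ 2) * moment a b s 1 + (3 * b) * moment a b s 2
    + (- 1) * moment a b s 3); last by rewrite /cmoment3; ring.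
  apply: pos => c cab _.
  rewrite [ltRHS](_ : _ = (b - c) ^+ 3); last by ring.
  by rewrite exprn_gt0 //; lra.
- rewrite [ltRHS](_ : _ = (b * (b - a) ^+ 2 - b ^+ 3) * moment a b s 0
    + (3 * b ^+ 2 - (b - a) ^+ 2) * moment a b s 1
    + (- 3 * b) * moment a b s 2 + 1 * moment a b s 3); last first.
    by rewrite /cmoment3 /cmoment1; ring.
  apply: pos => c cab _.
  rewrite [ltRHS](_ : _ = (b - c) * (c - a) * (2 * b - a - c)); last by ring.
  by rewrite !mulr_gt0 //; lra.
- rewrite [ltRHS](_ : _ = (- (a * b ^+ 2)) * moment a b s 0
    + (b ^+ 2 + 2 * a * b) * moment a b s 1
    + (- (a + 2 * b)) * moment a b s 2 + 1 * moment a b s 3); last first.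
    by rewrite /cmoment3 /cmoment2; ring.
  apply: pos => c cab _.
  rewrite [ltRHS](_ : _ = (b - c) ^+ 2 * (c - a)); last by ring.
  by rewrite mulr_gt0 ?exprn_gt0 //; lra.
Qed.

(** * The Hurwitz inequality at both endpoints *)

Lemma exponent_cases (s : int) :
  (forall k, (k < 4)%N -> s + k%:Z != 0) -> 1 <= s \/ s <= -4.
Proof.
by move=> hs; move: (hs 0%N isT) (hs 1%N isT) (hs 2%N isT) (hs 3%N isT); lia.
Qed.

(** The weight [c ^ (s - 1)] is nondecreasing for [1 <= s] and nonincreasing for [s <= 1]. *)
Lemma moment_midpoint_sign {R : realType} (a b : R) (s : int) :
  0 < a -> a < b -> (forall k, (k < 4)%N -> s + k%:Z != 0) ->
  (1 <= s -> (a + b) * moment a b s 0 <= 2 * moment a b s 1) /\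
  (s <= 1 -> 2 * moment a b s 1 <= (a + b) * moment a b s 0).
Proof.
move=> a0 ab hs.
have [c /andP[ac cb] mid] := moment_midpoint a b s a0 ab hs.
have c0 : 0 < c by exact: lt_trans ac.
have h0 : 0 < (a + b) / 2 by lra.
have L0 : 0 < 2 * (b - a) by lra.
rewrite -[(a + b) * _ <= _]subr_ge0 -[2 * _ <= _]subr_le0 mid.
rewrite (_ : _ * _ * (b - a) = (c ^ (s - 1) - ((a + b) / 2) ^ (s - 1))
  * (c - (a + b) / 2) * (2 * (b - a))); last by field.
rewrite pmulr_lge0 // pmulr_lle0 //.
by split=> s1; [apply: exprz_diff_ge0 | apply: exprz_diff_le0];
  rewrite ?subr_ge0 ?subr_le0.
Qed.

Lemma cmoment_hurwitz_left {R : realType} (a b : R) (s : int) :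
  0 < a -> a < b -> (forall k, (k < 4)%N -> s + k%:Z != 0) ->
  moment a b s 0 * cmoment3 a b s a
    < 9 * cmoment1 a b s a * cmoment2 a b s a.
Proof.
move=> a0 ab hs; have b0 : 0 < b by exact: lt_trans ab.
have [M1 M3 M31 M32] := cmoment_left a b s a0 ab hs.
have M2 := cmoment2_gt0 a b s a a0 ab hs.
have M0 := moment0_gt0 a b s a0 ab hs.
have [s1|s4] := exponent_cases s hs.
  apply: (hurwitz_of_mean (b - a)) => //.
  have [h _] := moment_midpoint_sign a b s a0 ab hs.
  by have := h s1; rewrite /cmoment1; lra.
have [r0 r2] := cmoment_recursion a b s a a0 b0 hs.
apply: (hurwitz_of_recursion a (b ^ s) (b - a) (- (s%:~R + 1)) (- (s%:~R + 3))).
- by [].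
- by rewrite exprz_gt0.
- by rewrite subr_gt0.
(* The condition [al <= 3 * be] amounts to [s <= -4], with equality at [p = -1]. *)
- have : s%:~R <= (-4)%:~R :> R by rewrite ler_int.
  by lra.
- by [].
- by [].
- by [].
- by rewrite r0; ring.
- by rewrite r2; ring.
Qed.

Lemma cmoment_hurwitz_right {R : realType} (a b : R) (s : int) :
  0 < a -> a < b -> (forall k, (k < 4)%N -> s + k%:Z != 0) ->
  9 * cmoment1 a b s b * cmoment2 a b s b
    < moment a b s 0 * cmoment3 a b s b.
Proof.
move=> a0 ab hs; have b0 : 0 < b by exact: lt_trans ab.
have [M1 M3 M31 M32] := cmoment_right a b s a0 ab hs.
have M2 := cmoment2_gt0 a b s b a0 ab hs.
have M0 := moment0_gt0 a b s a0 ab hs.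
suff : moment a b s 0 * - cmoment3 a b s b
    < 9 * - cmoment1 a b s b * cmoment2 a b s b by lra.
have [s1|s4] := exponent_cases s hs; last first.
  apply: (hurwitz_of_mean (b - a)) => //.
  have [_ h] := moment_midpoint_sign a b s a0 ab hs.
  have s1 : s <= 1 by clear -s4; lia.
  by have := h s1; rewrite /cmoment1; lra.
have [r0 r2] := cmoment_recursion a b s b a0 b0 hs.
apply: (hurwitz_of_recursion b (a ^ s) (b - a) (s%:~R + 1) (s%:~R + 3)).
- by [].
- by rewrite exprz_gt0.
- by rewrite subr_gt0.
(* Here [al <= 3 * be] only asks for [-4 <= s]. *)
- have : 1%:~R <= s%:~R :> R by rewrite ler_int.
  by lra.
- by [].
- by [].
- by [].
- by rewrite r0; ring.
- by rewrite r2; ring.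
Qed.

(** * Real cubics with a single real root *)

(** The sign change on [[a, b]] gives a real root [r]; the Cauchy-Schwarz hypothesis makes the
    discriminant of the derivative negative, so the other two roots are nonreal. The conclusion is
    Vieta's relations for [r] and [x] ± [i y]. *)
Lemma cubic_nonreal_factor {R : realType} (m0 m1 m2 m3 a b : R) :
  a <= b -> 0 < m0 -> m1 ^+ 2 < m0 * m2 ->
  0 <= m3 - 3 * a * m2 + 3 * a ^+ 2 * m1 - a ^+ 3 * m0 ->
  m3 - 3 * b * m2 + 3 * b ^+ 2 * m1 - b ^+ 3 * m0 <= 0 ->
  exists r x y : R, [/\ y != 0, 3 * m1 = m0 * (r + 2 * x),
    3 * m2 = m0 * (2 * r * x + x ^+ 2 + y ^+ 2)
  & m3 = m0 * (r * (x ^+ 2 + y ^+ 2))].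
Proof.
move=> ab m0_gt0 cs ha hb.
have m0_neq0 : m0 != 0 by rewrite lt0r_neq0.
pose G : {poly R} := m0 *: 'X^3 - (3 * m1) *: 'X^2 + (3 * m2) *: 'X - m3%:P.
have GE x : G.[x] = m0 * x ^+ 3 - 3 * m1 * x ^+ 2 + 3 * m2 * x - m3.
  by rewrite /G !hornerE.
have [|r _] := @poly_ivt R G a b ab; first by rewrite !GE; lra.
rewrite rootE GE => /eqP Gr.
(* Vieta forces both values: [2 * x] is the sum of the other two roots, and [z] is the future
   [y ^+ 2]. *)
pose x := (3 * m1 / m0 - r) / 2.
pose z := 3 * m2 / m0 - 2 * r * x - x ^+ 2.
have e1 : 3 * m1 = m0 * (r + 2 * x) by rewrite /x; field.
have e2 : 3 * m2 = m0 * (2 * r * x + x ^+ 2 + z) by rewrite /z; field.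
have z_gt0 : 0 < z.
  have h : 0 < m0 ^+ 2 * (3 * z - (r - x) ^+ 2).
    rewrite [ltRHS](_ : _ = 3 * (m0 * (3 * m2)) - (3 * m1) ^+ 2); last first.
      by rewrite e1 e2; ring.
    by lra.
  have := sqr_ge0 (r - x).
  by move: h; rewrite pmulr_rgt0 ?exprn_gt0 //; lra.
exists r, x, (Num.sqrt z); rewrite sqr_sqrtr ?(ltW z_gt0) //; split => //.
  by rewrite lt0r_neq0 // sqrtr_gt0.
by move: Gr; rewrite e1 e2 => Gr; lra.
Qed.

(* The sign of the left-hand side locates the real part [x] relative to [e]. *)
Lemma cubic_hurwitz {R : realType} (m0 m1 m2 m3 r x y e : R) :
  3 * m1 = m0 * (r + 2 * x) ->
  3 * m2 = m0 * (2 * r * x + x ^+ 2 + y ^+ 2) ->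
  m3 = m0 * (r * (x ^+ 2 + y ^+ 2)) ->
  9 * (m1 - e * m0) * (m2 - 2 * e * m1 + e ^+ 2 * m0)
  - m0 * (m3 - 3 * e * m2 + 3 * e ^+ 2 * m1 - e ^+ 3 * m0)
  = 2 * m0 ^+ 2 * (x - e) * ((r + x - 2 * e) ^+ 2 + y ^+ 2).
Proof.
move=> e1 e2 e3.
have -> : m1 = m0 * (r + 2 * x) / 3 by rewrite -e1; field.
have -> : m2 = m0 * (2 * r * x + x ^+ 2 + y ^+ 2) / 3 by rewrite -e2; field.
by rewrite e3; field.
Qed.

(** * The difference of Taylor polynomials as a complex cubic *)

Lemma horner_taylor_exprz {R : realType} (p : int) (c : R) (z : R[i]) : 0 < c ->
  (taylor_poly (fun x : R => x ^ p) 3 c).[z] =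
  (c ^ (p - 3))%:C * ((c%:C) ^+ 3 + p%:~R * (c%:C) ^+ 2 * (z - c%:C)
    + p%:~R * (p%:~R - 1) / 2 * c%:C * (z - c%:C) ^+ 2
    + p%:~R * (p%:~R - 1) * (p%:~R - 2) / 6 * (z - c%:C) ^+ 3).
Proof.
move=> c0.
(* Factoring out [c ^ (p - 3)] leaves only natural powers of [c], within reach of [field]. *)
have e (k : nat) : (k < 4)%N -> c ^ (p - k%:Z) = c ^ (p - 3) * c ^+ (3 - k).
  by move=> k3; rewrite exprnP -expfzDr ?lt0r_neq0 //; congr (_ ^ _); lia.
rewrite /taylor_poly horner_sum.
under eq_bigr => k _.
  rewrite derive1n_exprz // e ?ltn_ord // hornerZ horner_exp hornerXsubC.
  over.
set C := c ^ (p - 3).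
rewrite !big_ord_recr !big_ord0 /= !intrB /=.
rewrite (_ : 3`! = 6%N) // (_ : 2`! = 2%N) //.
rewrite (_ : 1`! = 1%N) // (_ : 0`! = 1%N) //.
have -> (n : nat) (x : R) : (x / n%:R)%:C = x%:C / n%:R.
  by rewrite rmorphM fmorphV rmorph_nat.
rewrite !subSS !subn0.
rewrite !(rmorphM, rmorphB, rmorphXn, rmorph_int, rmorph1, rmorph0) /=.
move: (c%:C) (C%:C) (p%:~R : R[i]) => u v w.
by field.
Qed.

(** The coefficient of [z ^+ (3 - k)] in the Taylor polynomial at [c] is a multiple of
    [c ^ (p - 3 + k)], whose increment from [a] to [b] is [p - 3 + k] times the [k]-th moment. *)
Lemma horner_taylor_diff {R : realType} (p : int) (a b : R) (z : R[i]) :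
  0 < a -> 0 < b -> (forall k, (k < 4)%N -> p - 3 + k%:Z != 0) ->
  let m k := (moment a b (p - 3) k)%:C in
  (taylor_poly (fun x : R => x ^ p) 3 b
   - taylor_poly (fun x : R => x ^ p) 3 a).[z]
  = p%:~R * (p%:~R - 1) * (p%:~R - 2) * (p%:~R - 3) / 6
    * (m 0%N * z ^+ 3 - 3 * m 1%N * z ^+ 2 + 3 * m 2%N * z - m 3%N).
Proof.
move=> a0 b0 hs m.
have eM (k : nat) : (k < 4)%N ->
    (p%:~R - 3 + k%:R) * m k
    = (b%:C) ^+ k * (b ^ (p - 3))%:C - (a%:C) ^+ k * (a ^ (p - 3))%:C.
  move=> k4; have := momentE a b (p - 3) k a0 b0 (hs k k4).
  rewrite /m intrB; move: (moment _ _ _ _) => mk /(congr1 (real_complex R)).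
  by rewrite !(rmorphM, rmorphB, rmorphD, rmorphXn, rmorph_int, rmorph_nat).
have e0 := eM 0%N isT; have e1 := eM 1%N isT.
have e2 := eM 2%N isT; have e3 := eM 3%N isT.
rewrite hornerD hornerN !horner_taylor_exprz //.
move: e0 e1 e2 e3.
move: (b%:C) (a%:C) (b ^ _)%:C (a ^ _)%:C (m 0%N) (m 1%N) (m 2%N) (m 3%N).
move: (p%:~R : R[i]) => P u v B A m0 m1 m2 m3 e0 e1 e2 e3.
(* Each moment is paired with its own factor of [P * (P - 1) * (P - 2) * (P - 3)], ready for [e0] to
   [e3]. *)
rewrite [RHS](_ : _ = (P * (P - 1) * (P - 2) * z ^+ 3 * ((P - 3 + 0) * m0)
  - 3 * P * (P - 1) * (P - 3) * z ^+ 2 * ((P - 3 + 1) * m1)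
  + 3 * P * (P - 2) * (P - 3) * z * ((P - 3 + 2) * m2)
  - (P - 1) * (P - 2) * (P - 3) * ((P - 3 + 3) * m3)) / 6); last by field.
by rewrite e0 e1 e2 e3; field.
Qed.

Lemma complex_cubic_factor {R : realType} (m0 m1 m2 m3 r x y : R) (z : R[i]) :
  3 * m1 = m0 * (r + 2 * x) ->
  3 * m2 = m0 * (2 * r * x + x ^+ 2 + y ^+ 2) ->
  m3 = m0 * (r * (x ^+ 2 + y ^+ 2)) ->
  m0%:C * z ^+ 3 - 3 * m1%:C * z ^+ 2 + 3 * m2%:C * z - m3%:C
  = m0%:C * (z - r%:C) * ((z - x%:C) ^+ 2 + (y%:C) ^+ 2).
Proof.
move=> /(congr1 (real_complex R)) e1 /(congr1 (real_complex R)) e2 e3.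
rewrite !(rmorphM, rmorphD, rmorphXn, rmorph_nat) /= in e1 e2.
rewrite e3 !(rmorphM, rmorphD, rmorphXn, rmorph_nat) /=.
by rewrite e1 e2; ring.
Qed.

Theorem theorem1 (R : realType) (p : int)
    (hp0 : p <> 0) (hp1 : p <> 1) (hp2 : p <> 2) (hp3 : p <> 3)
    (a b : R) (ha : 0 < a) (hab : a < b) :
  let f : R -> R := fun x => x ^ p in
  let Q : {poly R[i]} := taylor_poly f 3 b - taylor_poly f 3 a in
  exists x1 y1 : R,
    [/\ y1 <> 0, root Q (x1 +i* y1), root Q (x1 -i* y1) & a < x1 < b].
Proof.
move=> f Q.
have hb : 0 < b by exact: lt_trans hab.
have hs (k : nat) : (k < 4)%N -> p - 3 + k%:Z != 0.
  by clear -hp0 hp1 hp2 hp3; lia.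
have m0_gt0 := moment0_gt0 a b (p - 3) ha hab hs.
have [_ Ma _ _] := cmoment_left a b (p - 3) ha hab hs.
have [_ Mb _ _] := cmoment_right a b (p - 3) ha hab hs.
have [|r [x [y [y0 e1 e2 e3]]]] :=
  cubic_nonreal_factor _ _ _ _ a b (ltW hab) m0_gt0
  (moment_cauchy_schwarz a b (p - 3) ha hab hs) (ltW Ma).
  by rewrite -oppr_ge0 ltW.
(* Such a [z] annihilates the quadratic factor of the cubic. *)
have rootQ z : (z - x%:C) ^+ 2 = - (y%:C) ^+ 2 -> root Q z.
  move=> hz; rewrite rootE /Q horner_taylor_diff //.
  by rewrite (complex_cubic_factor _ _ _ _ _ _ _ z e1 e2 e3) hz addNr !mulr0.
have hyp e := cubic_hurwitz _ _ _ _ r x y e e1 e2 e3.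
have y2 : 0 < y ^+ 2 by rewrite exprn_even_gt0.
have K : 0 < 2 * moment a b (p - 3) 0 ^+ 2.
  by rewrite mulr_gt0 ?exprn_gt0.
have D e : 0 < (r + x - 2 * e) ^+ 2 + y ^+ 2 by rewrite ltr_wpDl ?sqr_ge0.
exists x, y; split; first exact/eqP.
- apply: rootQ; simpc.
  by congr (_ +i* _); ring.
- apply: rootQ; simpc.
  by congr (_ +i* _); ring.
- have := cmoment_hurwitz_left a b (p - 3) ha hab hs.
  have := cmoment_hurwitz_right a b (p - 3) ha hab hs.
  (* By [cubic_hurwitz], the two Hurwitz differences are positive multiples of [x - b] and
     [x - a]. *)
  rewrite -[_ < moment _ _ _ _ * _]subr_lt0 -[_ < 9 * _ * _]subr_gt0.
  rewrite /cmoment1 /cmoment2 /cmoment3 !hyp.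
  rewrite pmulr_llt0 // pmulr_rlt0 // subr_lt0 => ->.
  by rewrite pmulr_lgt0 // pmulr_rgt0 // subr_gt0 => ->.
Qed.
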